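(* Let $n\in\mathbb{N}$, let $q\in\mathbb{C}$ be nonzero, and let $\Lambda=\mathrm{diag}(\lambda_0,\lambda_1,\dots,\lambda_n)$ be a complex diagonal matrix with all $\lambda_r\neq 0$ such that $$\lambda_0\lambda_n\,\frac{q_rq_{n-r}}{q_n}=\lambda_r\lambda_{n-r},\qquad 0\le r\le n .$$ Put $\sigma_1^{\Lambda}:=\sigma_1(q,n)\Lambda$ and $\sigma_2^{\Lambda}:=\Lambda^\sharp\sigma_2(q,n)$. Then $\sigma_1\mapsto\sigma_1^\Lambda$, $\sigma_2\mapsto\sigma_2^\Lambda$ defines a representation of the braid group $B_3$ in $\mathbb{C}^{n+1}$, i.e. $$\sigma_1^{\Lambda}\sigma_2^{\Lambda}\sigma_1^{\Lambda}=\sigma_2^{\Lambda}\sigma_1^{\Lambda}\sigma_2^{\Lambda}=\lambda_0\lambda_n S(q)\Lambda .$$ Moreover, the entries of $\sigma_2(q,n)=(\sigma_1^{-1}(q^{-1},n))^\sharp$ are $$\bigl((\sigma_1^{-1}(q^{-1},n))^\sharp\bigr)_{km}=\begin{cases}0,& 0\le k<m\le n,\\ (-1)^{k+m}q_{k-m}^{-1}C_k^m(q^{-1}),& 0\le m\le k\le n.\end{cases}$$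
   Context: $\mathbb{N}=\{0,1,2,\dots\}$. $B_3=\langle\sigma_1,\sigma_2\mid\sigma_1\sigma_2\sigma_1=\sigma_2\sigma_1\sigma_2\rangle$. Rows and columns of $(n+1)\times(n+1)$ matrices are indexed by $0,\dots,n$. For $A=(a_{ij})$, $A^\sharp=(a_{n-i,n-j})$. For $q\neq0$ and an integer $k$, $q_k:=q^{k(k-1)/2}$. $C_n^k(q)$ is the Gaussian ($q$-binomial) polynomial evaluated at $q$: $C_n^0(q)=C_n^n(q)=1$, $C_{n+1}^k(q)=C_n^{k-1}(q)+q^kC_n^k(q)$ for $1\le k\le n$, and $C_n^k(q)=0$ for $k>n$. The matrix $\sigma_1(q,n)$ has entries $\sigma_1(q,n)_{km}=C_{n-k}^{n-m}(q)$, $0\le k,m\le n$, and $\sigma_2(q,n):=(\sigma_1(q^{-1},n)^{-1})^\sharp$. The matrix $S(q)$ has entries $S(q)_{km}=q_k^{-1}(-1)^k\delta_{k+m,n}$, $0\le k,m\le n$. *)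

(* Defs.v *)
From HB Require Import structures.
From mathcomp Require Import all_boot all_order all_algebra.
From mathcomp Require Import generic_quotient boolp reals.
From mathcomp.real_closed Require Export complex.

Set Implicit Arguments.
Unset Strict Implicit.
Unset Printing Implicit Defensive.

Import Order.TTheory GRing.Theory Num.Theory.

Section BraidGroup.

Local Open Scope quotient_scope.

(* A letter (g, e) stands for sigma_1 (g = false) or sigma_2 (g = true), raised
   to the power 1 (e = false) or -1 (e = true). *)
Definition braid_word := seq (bool * bool).

Definition braid_inv (w : braid_word) : braid_word :=
  rev [seq (l.1, ~~ l.2) | l <- w].

Inductive braid_cong : braid_word -> braid_word -> Prop :=
| braid_cong_refl u : braid_cong u u
| braid_cong_sym u v : braid_cong u v -> braid_cong v u
| braid_cong_trans v u w : braid_cong u v -> braid_cong v w -> braid_cong u w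
| braid_cong_cat u u' v v' :
    braid_cong u u' -> braid_cong v v' -> braid_cong (u ++ v) (u' ++ v')
| braid_cong_cancel g e : braid_cong [:: (g, e); (g, ~~ e)] [::]
| braid_cong_braid :
    braid_cong [:: (false, false); (true, false); (false, false)]
               [:: (true, false); (false, false); (true, false)].

Definition braid_congb : rel braid_word := fun u v => `[< braid_cong u v >].

Fact braid_congb_refl : reflexive braid_congb.
Proof. by move=> u; apply/asboolP; exact: braid_cong_refl. Qed.

Fact braid_congb_sym : symmetric braid_congb.
Proof. by move=> u v; apply/asboolP/asboolP; exact: braid_cong_sym. Qed.

Fact braid_congb_trans : transitive braid_congb.
Proof.
move=> v u w /asboolP uv /asboolP vw; apply/asboolP.
exact: braid_cong_trans uv vw.
Qed.

Canonical braid_equiv :=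
  EquivRel braid_congb braid_congb_refl braid_congb_sym braid_congb_trans.

Definition B3 := {eq_quot braid_equiv}.

HB.instance Definition _ := Choice.on B3.

Lemma B3_eqP (u v : braid_word) :
  (\pi_{eq_quot braid_equiv} u = \pi_{eq_quot braid_equiv} v) <-> braid_cong u v.
Proof.
by split=> [/eqmodP /asboolP|uv] //; apply/eqmodP; apply/asboolP.
Qed.

Definition B3_class (w : braid_word) : B3 := \pi_{eq_quot braid_equiv} w.
Definition B3_one : B3 := B3_class [::].
Definition B3_mul (x y : B3) : B3 := B3_class (repr x ++ repr y).
Definition B3_inv (x : B3) : B3 := B3_class (braid_inv (repr x)).

Lemma B3_classP (x : B3) : exists w, x = B3_class w.
Proof. by exists (repr x); rewrite /B3_class reprK. Qed.

Lemma braid_cong_repr w : braid_cong (repr (B3_class w)) w.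
Proof. by apply/B3_eqP; rewrite reprK. Qed.

Lemma B3_class_cat u v : B3_mul (B3_class u) (B3_class v) = B3_class (u ++ v).
Proof. by apply/B3_eqP; apply: braid_cong_cat; exact: braid_cong_repr. Qed.

Lemma braid_cong_mulV w : braid_cong (w ++ braid_inv w) [::].
Proof.
elim: w => [|[g e] w IHw]; first exact: braid_cong_refl.
rewrite /braid_inv map_cons rev_cons -cats1 -/(braid_inv w) -cat1s -catA.
apply: braid_cong_trans (braid_cong_cancel g e).
rewrite -[X in braid_cong _ X]/([:: (g, e)] ++ [:: (g, ~~ e)]).
apply: braid_cong_cat; first exact: braid_cong_refl.
rewrite catA -[X in braid_cong _ X]cat0s.
by apply: braid_cong_cat IHw _; exact: braid_cong_refl.
Qed.

Lemma braid_invK : involutive braid_inv.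
Proof.
move=> w; rewrite /braid_inv map_rev revK -map_comp -[RHS]map_id.
by apply: eq_map => -[g e] /=; rewrite negbK.
Qed.

Fact B3_mulA : associative B3_mul.
Proof.
move=> x y z.
have [[u ->] [v ->] [w ->]] := And3 (B3_classP x) (B3_classP y) (B3_classP z).
by rewrite !B3_class_cat catA.
Qed.

Fact B3_mul1 : left_id B3_one B3_mul.
Proof. by move=> x; have [u ->] := B3_classP x; rewrite B3_class_cat. Qed.

Fact B3_mulr1 : right_id B3_one B3_mul.
Proof. by move=> x; have [u ->] := B3_classP x; rewrite B3_class_cat cats0. Qed.

Fact B3_mulV : left_inverse B3_one B3_inv B3_mul.
Proof.
move=> x; rewrite -{2}[x]reprK -/(B3_class _) B3_class_cat; apply/B3_eqP.
by rewrite -{2}[repr x]braid_invK; exact: braid_cong_mulV.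
Qed.

Fact B3_mulrV : right_inverse B3_one B3_inv B3_mul.
Proof.
move=> x; rewrite -{1}[x]reprK -/(B3_class _) B3_class_cat; apply/B3_eqP.
exact: braid_cong_mulV.
Qed.

HB.instance Definition _ :=
  isGroup.Build B3 B3_mulA B3_mul1 B3_mulr1 B3_mulV B3_mulrV.

Definition braid1 : B3 := B3_class [:: (false, false)].
Definition braid2 : B3 := B3_class [:: (true, false)].

Local Open Scope group_scope.

Lemma braid_relation : braid1 * braid2 * braid1 = braid2 * braid1 * braid2.
Proof.
have E (x y : B3) : x * y = B3_mul x y by [].
rewrite !E (B3_class_cat [:: (false, false)]) (B3_class_cat [:: (true, false)]).
rewrite !B3_class_cat; apply/B3_eqP; exact: braid_cong_braid.
Qed.

Lemma B3_universal (G : groupType) (a b : G) : a * b * a = b * a * b ->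
  exists f : B3 -> G, [/\ monoid.monoid_morphism f, f braid1 = a & f braid2 = b].
Proof.
move=> aba; pose letter (l : bool * bool) : G :=
  let x := if l.1 then b else a in if l.2 then x^-1 else x.
pose ev (w : braid_word) : G := foldr (fun l x => letter l * x) 1 w.
have evM u v : ev (u ++ v) = ev u * ev v.
  by elim: u => [|l u IHu] /=; rewrite ?mul1g // IHu mulgA.
have evE u v : braid_cong u v -> ev u = ev v.
  elim=> {u v} //.
  - by move=> v u w _ -> _.
  - by move=> u u' v v' _ eu _ ev'; rewrite !evM eu ev'.
  - by case=> [] [] /=; rewrite /letter /= mulg1 ?mulVg ?mulgV.
  - by rewrite /= /letter /= !mulg1 !mulgA.
have evC w : ev (repr (B3_class w)) = ev w by apply/evE/braid_cong_repr.
exists (fun x => ev (repr x)); split; rewrite ?evC /= /letter /= ?mulg1 //.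
by split=> [|x y]; rewrite evC ?evM.
Qed.

Lemma B3_generated (G : groupType) (f g : B3 -> G) :
  monoid.monoid_morphism f -> monoid.monoid_morphism g ->
  f braid1 = g braid1 -> f braid2 = g braid2 -> f =1 g.
Proof.
move=> [f1 fM] [g1 gM] e1 e2 x; have [w ->] := B3_classP x.
have mV (h : B3 -> G) : (h 1 = 1)%g -> {morph h : x y / (x * y)%g} ->
    forall y, h y^-1 = (h y)^-1.
  by move=> h1 hM y; apply: (mulgI (h y)); rewrite -hM !mulgV.
have inv1 c : B3_class [:: (c, true)] = (B3_class [:: (c, false)])^-1.
  apply: (mulgI (B3_class [:: (c, false)])); rewrite mulgV.
  rewrite -[LHS]/(B3_mul _ _) B3_class_cat; apply/B3_eqP.
  exact: (braid_cong_cancel c false).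
have e c : f (B3_class [:: (c, false)]) = g (B3_class [:: (c, false)]).
  by case: c.
elim: w => [|[c s] w IHw]; first by rewrite -/(1 : B3) f1 g1.
rewrite -cat1s -B3_class_cat -[B3_mul _ _]/(@monoid.mul B3 _ _) fM gM IHw.
congr (_ * _).
by case: s; rewrite ?inv1 ?(mV f) ?(mV g) // e.
Qed.

End BraidGroup.

Local Open Scope ring_scope.

(* The analogue of mathcomp's mx_repr for a possibly infinite group. *)
Definition group_mx_repr (F : fieldType) (G : groupType) (d : nat)
    (rho : G -> 'M[F]_d) : Prop :=
  rho 1%g = 1%:M /\ {morph rho : x y / (x * y)%g >-> x *m y}.

Section QPascal.

Variable F : fieldType.

Definition qtri (q : F) (k : int) : F := q ^ divz (k * (k - 1)) 2.

(* The clause C_n^n = 1 follows from the recursion (see qbin_nn). *)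
Fixpoint qbin (q : F) (n k : nat) {struct n} : F :=
  match n, k with
  | _, 0%N => 1
  | 0%N, _.+1 => 0
  | n'.+1, k'.+1 => qbin q n' k' + q ^+ k * qbin q n' k
  end.

Lemma qbin_n0 q n : qbin q n 0 = 1. Proof. by case: n. Qed.

Lemma qbin_gt q n k : (n < k)%N -> qbin q n k = 0.
Proof.
elim: n k => [|n IHn] [|k] //= nk.
by rewrite !IHn ?mulr0 ?addr0 // ltnW.
Qed.

Lemma qbin_nn q n : qbin q n n = 1.
Proof. by elim: n => //= n ->; rewrite qbin_gt // mulr0 addr0. Qed.

Lemma qbin_rec q n k : (1 <= k <= n)%N ->
  qbin q n.+1 k = qbin q n k.-1 + q ^+ k * qbin q n k.
Proof. by case: k. Qed.

Definition sharp (n : nat) (A : 'M[F]_n) : 'M[F]_n :=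
  \matrix_(i, j) A (rev_ord i) (rev_ord j).

Definition sigma1 (q : F) (n : nat) : 'M[F]_n.+1 :=
  \matrix_(k, m) qbin q (n - k) (n - m).

Definition sigma2 (q : F) (n : nat) : 'M[F]_n.+1 :=
  sharp (invmx (sigma1 q^-1 n)).

Definition Smx (q : F) (n : nat) : 'M[F]_n.+1 :=
  \matrix_(k, m) ((qtri q k%:Z)^-1 * (-1) ^+ k * ((k + m)%N == n)%:R).

(* The genuine inverse is meant in sigma2: invmx is not used off unitmx. *)
Lemma sigma1_unitmx q n : sigma1 q n \in unitmx.
Proof.
rewrite unitmxE -det_tr det_trig.
  by rewrite big1 ?unitr1 // => i _; rewrite !mxE qbin_nn.
apply/is_trig_mxP => i j ij; rewrite !mxE qbin_gt //.
by rewrite ltn_sub2l // (leq_trans ij) // -ltnS.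
Qed.

Definition sigma1L (q : F) (n : nat) (lam : 'rV[F]_n.+1) : 'M[F]_n.+1 :=
  sigma1 q n *m diag_mx lam.

Definition sigma2L (q : F) (n : nat) (lam : 'rV[F]_n.+1) : 'M[F]_n.+1 :=
  sharp (diag_mx lam) *m sigma2 q n.

End QPascal.

(* Main.v *)
From HB Require Import structures.
Require Import Defs.
From mathcomp Require Import all_boot all_order all_algebra.
From mathcomp Require Import ring zify.
From mathcomp Require Import reals.
From mathcomp.real_closed Require Import complex.
Import Order.TTheory GRing.Theory Num.Theory.
Local Open Scope ring_scope.

(** Write A = sigma1(q,n), B = sigma2(q,n), S = S(q), D = diag(q^(-r(n-r))).  The
condition on Lambda says that Lambda Lambda^sharp = lambda_0 lambda_n D, and
Lambda^sharp S = S Lambda, so both braid words reduce to A D B A = S = B A D B.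
Now B^-1 = A(q^-1)^sharp has entries C_k^m(q^-1), and these identities follow from
S A^-1 = B^-1 S and A S^-1 A = B^-1 D^-1.  The first is the reflection
C_k^m(q) = q^(m(k-m)) C_k^m(q^-1).  The second is the alternating q-Vandermonde sum
[qbin_alternating_sum], whose case a = 0 also gives the entries of A^-1. *)

(** * Gaussian binomials *)

Lemma qbinS {F : fieldType} (q : F) (n k : nat) :
  qbin q n.+1 k.+1 = qbin q n k + q ^+ k.+1 * qbin q n k.+1.
Proof. by []. Qed.

(** The dual Pascal rule, with the power of q on the other term. Writing the upper index as j + d
    keeps the exponent d free of subtraction. *)
Lemma qbinSr {F : fieldType} (q : F) (j d : nat) :
  qbin q (j + d).+1 j.+1 = qbin q (j + d) j.+1 + q ^+ d * qbin q (j + d) j.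
Proof.
elim: j d => [|j IHj] d.
  elim: d => [|d IHd]; first by rewrite /= mulr0 !mul1r addr0 add0r.
  rewrite addnS qbinS {1}IHd qbinS !qbin_n0 !exprS; ring.
elim: d => [|d IHd].
  by rewrite addn0 !qbin_nn qbin_gt // add0r mul1r.
have E1 := IHj d.+1; rewrite addnS in E1.
rewrite addSn addnS in IHd *.
rewrite qbinS [in RHS](qbinS q (j + d).+1 j) [in RHS](qbinS q (j + d).+1).
rewrite E1 IHd.
rewrite !exprS; ring.
Qed.

(** The reflection k -> n - k exchanges the two Pascal rules, so a double induction closes. *)
Lemma qbin_sym {F : fieldType} (q : F) (a b : nat) :
  qbin q (a + b) a = qbin q (a + b) b.
Proof.
elim: a b => [|a IHa] b; first by rewrite qbin_n0 qbin_nn.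
elim: b => [|b IHb]; first by rewrite addn0 qbin_nn qbin_n0.
have E := qbinSr q b a.+1; rewrite addnS [(b + a)%N]addnC in E.
have Ea := IHa b.+1; rewrite addnS in Ea; rewrite addSn in IHb.
by rewrite addSn addnS {}E -{}IHb qbinS Ea.
Qed.

Lemma qbinC {F : fieldType} (q : F) (n k : nat) : (k <= n)%N ->
  qbin q n (n - k) = qbin q n k.
Proof. by move=> kn; have := qbin_sym q (n - k) k; rewrite subnK. Qed.

(** Induction on j and d: the defining rule at q on the left matches the dual rule at q^-1 on the
    right. *)
Lemma qbinV {F : fieldType} (q : F) (j d : nat) : q != 0 ->
  qbin q (j + d) j = q ^+ (j * d) * qbin q^-1 (j + d) j.
Proof.
move=> q0; elim: j d => [|j IHj] d; first by rewrite !qbin_n0 mulr1.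
elim: d => [|d IHd]; first by rewrite addn0 !qbin_nn muln0 mulr1.
have E := IHj d.+1; rewrite addnS in E.
rewrite addSn in IHd; rewrite addSn addnS qbinS {}E {}IHd.
have := qbinSr q^-1 j d.+1; rewrite addnS => ->.
have qd0 : q ^+ d != 0 by rewrite expf_neq0.
rewrite !mulSn !mulnS !exprD !exprS !exprVn; field.
by rewrite q0 qd0.

Qed.

(** Call the sum F(N, a), with M fixed. The dual Pascal rule on C_{N+1}^j gives F(N+1, a) = F(N,
    a+1) - q^N F(N, a), and the defining rule for C_{a+1}^m shows that the right side obeys the same
    recursion. *)
Lemma qbin_alternating_sum {F : fieldType} (q : F) (N a m M : nat) :
  (M + m = N + a)%N ->
  \sum_(j < N.+1) (-1) ^+ j * q ^+ 'C(j, 2) * qbin q N j * qbin q (N + a - j) M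
  = q ^+ (m * N) * qbin q a m.
Proof.
elim: N a m => [|N IHN] a m MmNa.
  rewrite big_ord1 subn0 add0n muln0 !expr0 !mul1r.
  have -> : M = (a - m)%N by lia.
  by rewrite qbinC //; lia.
have := IHN a.+1 m; rewrite addnS -addSn => /(_ MmNa).
have -> : \sum_(j < N.+2) (-1) ^+ j * q ^+ 'C(j, 2) * qbin q N.+1 j *
      qbin q (N.+1 + a - j) M
    = \sum_(j < N.+1) (-1) ^+ j * q ^+ 'C(j, 2) * qbin q N j *
        qbin q (N.+1 + a - j) M
    - q ^+ N * \sum_(j < N.+1) (-1) ^+ j * q ^+ 'C(j, 2) * qbin q N j *
        qbin q (N + a - j) M.
  rewrite big_ord_recl [in X in _ = X - _]big_ord_recl !qbin_n0 -addrA.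
  congr (_ + _).
  rewrite (eq_bigr (fun j : 'I_N.+1 => (-1) ^+ j.+1 * q ^+ 'C(j.+1, 2) *
       qbin q N j.+1 * qbin q (N.+1 + a - j.+1) M
     - q ^+ N * ((-1) ^+ j * q ^+ 'C(j, 2) * qbin q N j *
        qbin q (N + a - j) M))); last first.
    move=> j _; have jN : (j <= N)%N by rewrite -ltnS.
    rewrite lift0 addSn subSS binS bin1.
    (* Since 'C(j+1, 2) = 'C(j, 2) + j, the factor q^(N-j) of the dual rule is completed to q^N,
       which does not depend on j. *)
    have -> : q ^+ N = q ^+ j * q ^+ (N - j) by rewrite -exprD subnKC.
    have := qbinSr q j (N - j); rewrite subnKC // => ->.
    rewrite !exprD exprS; ring.
  rewrite sumrB -mulr_sumr big_ord_recr /= qbin_gt //.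
  by rewrite mulr0 mul0r addr0.
move=> ->.
(* For m = 0, M = N + 1 + a exceeds every upper index of the subtracted sum, which vanishes. *)
case: m MmNa => [|m] MmNa.
  rewrite big1 ?mulr0 ?subr0 ?qbin_n0 // => j _.
  by rewrite [qbin q (N + a - j) M]qbin_gt ?mulr0 //; lia.
rewrite (IHN a m); last by lia.
rewrite qbinS !mulnS !mulSn !exprD exprS; ring.
Qed.

(** * Triangular exponents *)

Lemma binD2 (a b : nat) : 'C(a + b, 2) = ('C(a, 2) + 'C(b, 2) + a * b)%N.
Proof.
elim: a => [|a IHa]; first by rewrite mul0n addn0.
by rewrite addSn !binS IHa !bin1; lia.
Qed.

Lemma qtri_nat {F : fieldType} (q : F) (k : nat) :
  qtri q k%:Z = q ^+ 'C(k, 2).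
Proof.
case: k => [|k]; first by rewrite /qtri mul0r.
rewrite /qtri bin2 -divn2 /=.
have -> : (k.+1%:Z * (k.+1%:Z - 1) = (k.+1 * k)%N%:Z)%R by lia.
by rewrite divz_nat.
Qed.

(** Only the cross term of [binD2] survives. This is where D comes from in the condition on
    Lambda. *)
Lemma qtriB {F : fieldType} (q : F) (n k : nat) : (k <= n)%N -> q != 0 ->
  qtri q k%:Z * qtri q (n%:Z - k%:Z) / qtri q n%:Z = (q ^+ (k * (n - k)))^-1.
Proof.
move=> kn q0; rewrite subzn // !qtri_nat -[in X in _ / X](subnKC kn) binD2.
by rewrite !exprD; field; rewrite !expf_neq0.
Qed.

(** * Reversed and antidiagonal matrices *)

Lemma sharpM {F : fieldType} {n : nat} (A B : 'M[F]_n) :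
  sharp (A *m B) = sharp A *m sharp B.
Proof.
apply/matrixP => i j; rewrite !mxE (reindex_inj rev_ord_inj).
by apply: eq_bigr => k _; rewrite !mxE.
Qed.

Lemma sharp1 {F : fieldType} (n : nat) : sharp (1%:M : 'M[F]_n) = 1%:M.
Proof. by apply/matrixP => i j; rewrite !mxE (inj_eq rev_ord_inj). Qed.

(** Common form of S(q) and its inverse, so that one pair of product rules serves both. *)
Definition antidiag_mx {F : fieldType} (n : nat) (c : nat -> F) : 'M[F]_n.+1 :=
  \matrix_(k, m) (c k * ((k + m)%N == n)%:R).

Lemma rev_ord_eq {n : nat} (k m : 'I_n.+1) :
  ((k + m)%N == n) = (m == rev_ord k).
Proof.
by rewrite -val_eqE /= subSS; apply/eqP/eqP; have := ltn_ord k; lia.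
Qed.

Lemma mul_antidiag_mx {F : fieldType} {n : nat} (c : nat -> F)
    (A : 'M[F]_n.+1) (k m : 'I_n.+1) :
  (antidiag_mx n c *m A) k m = c k * A (rev_ord k) m.
Proof.
rewrite mxE (bigD1 (rev_ord k)) //= big1 ?addr0 => [|j /negPf jk].
  by rewrite mxE rev_ord_eq eqxx mulr1.
by rewrite mxE rev_ord_eq jk mulr0 mul0r.
Qed.

Lemma mul_mx_antidiag {F : fieldType} {n : nat} (c : nat -> F)
    (A : 'M[F]_n.+1) (k m : 'I_n.+1) :
  (A *m antidiag_mx n c) k m = A k (rev_ord m) * c (n - m)%N.
Proof.
rewrite mxE (bigD1 (rev_ord m)) //= big1 ?addr0 => [|j /negPf jm].
  by rewrite mxE addnC rev_ord_eq eqxx mulr1 /= subSS.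
by rewrite mxE addnC rev_ord_eq jm !mulr0.
Qed.

(** * The inverse of sigma1 and its relations with S *)

Lemma SmxE {F : fieldType} (q : F) (n : nat) :
  Smx q n = antidiag_mx n (fun k => (q ^+ 'C(k, 2))^-1 * (-1) ^+ k).
Proof. by apply/matrixP => k m; rewrite !mxE qtri_nat. Qed.

(** A left inverse suffices. With r = k + j, entry (k, m) of the product for k <= m is the
    alternating sum with N = n - k and a = 0, a multiple of C_0^(m-k), hence zero off the
    diagonal. *)
Lemma invmx_sigma1 {F : fieldType} (q : F) (n : nat) :
  invmx (sigma1 q n) = \matrix_(k, m)
    ((-1) ^+ (m - k) * q ^+ 'C(m - k, 2) * qbin q (n - k) (n - m)).
Proof.
set V := (RHS); suff VA : V *m sigma1 q n = 1%:M.
  by rewrite -[RHS](mulmxK (sigma1_unitmx q n)) VA mul1mx.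
apply/matrixP => k m; have kn := ltn_ord k; have mn := ltn_ord m.
pose G r := (-1) ^+ (r - k) * q ^+ 'C(r - k, 2) * qbin q (n - k) (n - r) *
  qbin q (n - r) (n - m).
rewrite !mxE (eq_bigr (fun r : 'I_n.+1 => G r)); last by move=> r _; rewrite !mxE.
rewrite -(big_mkord xpredT G) (big_cat_nat (n := k)) //=; last exact: ltnW.
(* Terms with r < k vanish because n - r > n - k; the truncated r - k is harmless there. *)
rewrite big_nat big1 ?add0r => [|r rk]; last first.
  by rewrite /G [qbin q (n - k) _]qbin_gt ?mulr0 ?mul0r //; lia.
rewrite -{1}[nat_of_ord k]add0n big_addn big_mkord subSn //.
have [mk|km] := ltnP m k.
  rewrite big1 => [|r _]; first by rewrite -val_eqE /= gtn_eqF.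
  by rewrite /G [qbin q _ (n - m)]qbin_gt ?mulr0 //; lia.
have := @qbin_alternating_sum F q (n - k) 0 (m - k) (n - m).
rewrite addn0 => sum; transitivity (q ^+ ((m - k) * (n - k)) * qbin q 0 (m - k)).
  rewrite -{}sum; last by lia.
  apply: eq_bigr => r _; have rn := ltn_ord r; rewrite /G addnK.
  rewrite -(@qbinC F q (n - k) r) -?subnDA 1?[(k + r)%N]addnC //; lia.
rewrite -[k == m]/(k == m :> nat); have [->|/eqP nkm] := eqP; first by rewrite subnn !mulr1.
by rewrite qbin_gt ?mulr0 //; lia.
Qed.

Lemma sharp_sigma1 {F : fieldType} (q : F) (n : nat) (k m : 'I_n.+1) :
  sharp (sigma1 q n) k m = qbin q k m.
Proof.
by rewrite !mxE /= !subSS !subKn // -ltnS.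
Qed.

Lemma sigma2_mul_sharp {F : fieldType} (q : F) (n : nat) :
  sigma2 q n *m sharp (sigma1 q^-1 n) = 1%:M.
Proof. by rewrite /sigma2 -sharpM mulVmx ?sharp1 ?sigma1_unitmx. Qed.

(** The middle factor is S(q)^-1. Entry (k, m) is the alternating sum with N = n - k and a = k, that
    is q^(m(n-k)) C_k^m(q); reflection contributes q^(m(k-m)), and the exponents add up to
    m(n-m). *)
Lemma sigma1_antidiag_sigma1 {F : fieldType} (q : F) (n : nat) : q != 0 ->
  sigma1 q n *m antidiag_mx n (fun k => q ^+ 'C(n - k, 2) * (-1) ^+ (n - k))
    *m sigma1 q n
  = sharp (sigma1 q^-1 n) *m diag_mx (\row_r q ^+ (r * (n - r))).
Proof.
move=> q0; apply/matrixP => k m; rewrite mul_mx_diag [RHS]mxE sharp_sigma1 mxE.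
have [kn mn] : (k <= n)%N /\ (m <= n)%N by split; rewrite -ltnS.
have sum := @qbin_alternating_sum F q (n - k) k m (n - m).
rewrite !subnK // in sum; move: sum => /(_ erefl) sum.
rewrite [RHS]mulrC !mxE; transitivity (q ^+ (m * (n - k)) * qbin q k m).
  (* The matrix product runs to n, the alternating sum only to n - k; the extra C_{n-k}^j are
     zero. *)
  rewrite -{}sum (big_ord_widen n.+1 (fun j => (-1) ^+ j * q ^+ 'C(j, 2) *
    qbin q (n - k) j * qbin q (n - j) (n - m))) ?ltnS ?leq_subr //.
  rewrite [RHS]big_mkcond; apply: eq_bigr => j _; rewrite mul_mx_antidiag !mxE.
  have jn : (j <= n)%N by rewrite -ltnS.
  rewrite /= subSS !subKn //; case: ifP => jk; first by ring.
  by rewrite qbin_gt ?mul0r // leqNgt jk.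
have [km|mk] := ltnP k m; first by rewrite !qbin_gt ?mulr0.
have := @qbinV F q m (k - m) q0; rewrite subnKC // => ->.
rewrite mulrA -exprD -mulnDr; congr (q ^+ (m * _) * _); lia.
Qed.

Lemma sigma2E {F : fieldType} (q : F) (n : nat) (k m : 'I_n.+1) : q != 0 ->
  sigma2 q n k m =
    if (k < m)%N then 0
    else (-1) ^+ (k + m) * (qtri q (k%:Z - m%:Z))^-1 * qbin q^-1 k m.
Proof.
move=> q0; have [kn mn] : (k <= n)%N /\ (m <= n)%N by split; rewrite -ltnS.
rewrite /sigma2 invmx_sigma1 !mxE /= !subSS !subKn //.
have [km|mk] := ltnP k m; first by rewrite qbin_gt ?mulr0.
have -> : (n - m - (n - k) = k - m)%N by lia.
(* The signs agree since k - m and k + m have the same parity. *)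
rewrite subzn // qtri_nat exprVn -signr_odd oddB // -oddD signr_odd //.
Qed.

(** With j = n - m, the entries differ by the reflection of C_k^j, and [binD2] at k = j + (k - j)
    absorbs the power q^(j(k-j)). *)
Lemma Smx_invmx_sigma1 {F : fieldType} (q : F) (n : nat) : q != 0 ->
  Smx q n *m invmx (sigma1 q n) = sharp (sigma1 q^-1 n) *m Smx q n.
Proof.
move=> q0; apply/matrixP => k m.
have [kn mn] : (k <= n)%N /\ (m <= n)%N by split; rewrite -ltnS.
rewrite SmxE mul_antidiag_mx mul_mx_antidiag sharp_sigma1 invmx_sigma1 !mxE /=.
rewrite !subSS subKn //; have [knm|] := ltnP k (n - m).
  by rewrite !qbin_gt ?mulr0 ?mul0r.
move: (n - m)%N (subKn mn) => j <- jk.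
have -> : (n - j - (n - k) = k - j)%N by lia.
move: (k : nat) jk {kn} => {}k jk.
have := @qbinV F q j (k - j) q0; rewrite subnKC // => ->.
rewrite -(subnKC jk) addKn binD2 !exprD.
set e := (-1) ^+ (k - j).
have ee : e * e = 1 by rewrite -exprD addnn -signr_odd odd_double.
(* The left side carries the sign (-1)^(k-j) twice and the right side not at all; the factor e * e =
   1 makes the equation a formal identity. *)
rewrite -[RHS]mul1r -ee; field.
by rewrite !expf_neq0.
Qed.

(** * The two braid words without Lambda *)

Lemma Smx_mul_antidiag {F : fieldType} (q : F) (n : nat) : q != 0 ->
  Smx q n *m antidiag_mx n (fun k => q ^+ 'C(n - k, 2) * (-1) ^+ (n - k))
  = 1%:M.
Proof.
move=> q0; apply/matrixP => k m; have kn : (k <= n)%N by rewrite -ltnS.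
rewrite SmxE mul_antidiag_mx !mxE rev_ord_eq rev_ordK /= subSS subKn //.
rewrite [m == k]eq_sym mulrA mulrACA mulVf ?expf_neq0 // mul1r.
by rewrite -exprD addnn -signr_odd odd_double mul1r.
Qed.

(** Both sides invert A T A with T = S^-1: the left one because A T A = B^-1 D^-1, the right one by
    cancellation. *)
Lemma diag_sigma2 {F : fieldType} (q : F) (n : nat) : q != 0 ->
  diag_mx (\row_r (q ^+ (r * (n - r)))^-1) *m sigma2 q n
  = invmx (sigma1 q n) *m Smx q n *m invmx (sigma1 q n).
Proof.
move=> q0; have Au := sigma1_unitmx q n.
set D := diag_mx _; set A := sigma1 q n; set S := Smx q n.
pose E : 'M[F]_n.+1 := diag_mx (\row_r q ^+ (r * (n - r))).
have DE : D *m E = 1%:M.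
  rewrite mulmx_diag; apply/matrixP => i j; rewrite !mxE mulVf ?expf_neq0 //.
have W := sigma1_antidiag_sigma1 q n q0; set T := antidiag_mx _ _ in W.
have TS : T *m S = 1%:M by exact/mulmx1C/Smx_mul_antidiag.
have DBW : D *m sigma2 q n *m (A *m T *m A) = 1%:M.
  by rewrite W !mulmxA -[D *m _ *m _]mulmxA sigma2_mul_sharp mulmx1.
have WV : A *m T *m A *m (invmx A *m S *m invmx A) = 1%:M.
  by rewrite !mulmxA mulmxK // -(mulmxA A) TS mulmx1 mulmxV.
by rewrite -[LHS]mulmx1 -WV mulmxA DBW mul1mx.
Qed.

Lemma sigma1_diag_sigma2_sigma1 {F : fieldType} (q : F) (n : nat) : q != 0 ->
  sigma1 q n *m diag_mx (\row_r (q ^+ (r * (n - r)))^-1) *m sigma2 q n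
    *m sigma1 q n = Smx q n.
Proof.
move=> q0; rewrite -[sigma1 q n *m _ *m _]mulmxA diag_sigma2 // !mulmxA.
by rewrite mulmxV ?mul1mx ?mulmxKV ?sigma1_unitmx.
Qed.

(** Substituting for D B leaves B S A^-1, and S A^-1 = B^-1 S finishes. *)
Lemma sigma2_sigma1_diag_sigma2 {F : fieldType} (q : F) (n : nat) : q != 0 ->
  sigma2 q n *m sigma1 q n *m diag_mx (\row_r (q ^+ (r * (n - r)))^-1)
    *m sigma2 q n = Smx q n.
Proof.
move=> q0; rewrite -mulmxA diag_sigma2 // -!mulmxA Smx_invmx_sigma1 //.
by rewrite mulKVmx ?sigma1_unitmx // mulmxA sigma2_mul_sharp mul1mx.
Qed.

(** * Invertible matrices and representations of B3 *)

Lemma diag_mx_unit {F : fieldType} {d : nat} (v : 'rV[F]_d) :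
  (forall i, v 0 i != 0) -> diag_mx v \in unitmx.
Proof.
move=> v0; rewrite unitmxE det_diag unitfE; apply/prodf_neq0 => i _; exact: v0.
Qed.

(** GL_d(F), made a group so that [B3_universal] can take it as target. *)
Definition invertible_mx (F : fieldType) (d : nat) :=
  {A : 'M[F]_d | A \in unitmx}.

HB.instance Definition _ (F : fieldType) (d : nat) :=
  Choice.on (invertible_mx F d).

Section InvertibleMatrices.

Variables (F : fieldType) (d : nat).
Implicit Types A B : invertible_mx F d.

Definition invertible_mx1 : invertible_mx F d := Sub 1%:M (unitmx1 F d).

Fact invertible_mx_mul_subproof A B : val A *m val B \in unitmx.
Proof. by rewrite unitmx_mul (valP A) (valP B). Qed.

Definition invertible_mx_mul A B : invertible_mx F d :=
  Sub (val A *m val B) (invertible_mx_mul_subproof A B).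

Fact invertible_mx_inv_subproof A : invmx (val A) \in unitmx.
Proof. by rewrite unitmx_inv (valP A). Qed.

Definition invertible_mx_inv A : invertible_mx F d :=
  Sub (invmx (val A)) (invertible_mx_inv_subproof A).

Fact invertible_mx_mulA : associative invertible_mx_mul.
Proof. by move=> A B C; apply: val_inj; rewrite /= mulmxA. Qed.

Fact invertible_mx_mul1 : left_id invertible_mx1 invertible_mx_mul.
Proof. by move=> A; apply: val_inj; rewrite /= mul1mx. Qed.

Fact invertible_mx_mulr1 : right_id invertible_mx1 invertible_mx_mul.
Proof. by move=> A; apply: val_inj; rewrite /= mulmx1. Qed.

Fact invertible_mx_mulV :
  left_inverse invertible_mx1 invertible_mx_inv invertible_mx_mul.
Proof. by move=> A; apply: val_inj; rewrite /= mulVmx ?(valP A). Qed.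

Fact invertible_mx_mulrV :
  right_inverse invertible_mx1 invertible_mx_inv invertible_mx_mul.
Proof. by move=> A; apply: val_inj; rewrite /= mulmxV ?(valP A). Qed.

HB.instance Definition _ :=
  isGroup.Build (invertible_mx F d) invertible_mx_mulA invertible_mx_mul1
    invertible_mx_mulr1 invertible_mx_mulV invertible_mx_mulrV.

End InvertibleMatrices.

Lemma braid_mx_repr {F : fieldType} {d : nat} (a b : 'M[F]_d) :
  a \in unitmx -> b \in unitmx -> a *m b *m a = b *m a *m b ->
  exists rho : B3 -> 'M[F]_d,
    [/\ group_mx_repr rho, rho braid1 = a & rho braid2 = b].
Proof.
move=> au bu aba; pose A : invertible_mx F d := Sub a au.
pose B : invertible_mx F d := Sub b bu.
have ABA : (A * B * A = B * A * B)%g by apply: val_inj.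
have [f [[f1 fM] fa fb]] := B3_universal ABA.
exists (fun x => val (f x)); split; rewrite ?fa ?fb //.
by split=> [|x y]; rewrite ?f1 ?fM.
Qed.

Theorem theorem1 (R : realType) (n : nat) (q : R[i]) (lam : 'rV[R[i]]_n.+1)
    (q_neq0 : q != 0)
    (lam_neq0 : forall r : 'I_n.+1, lam 0 r != 0)
    (lam_cond : forall r : 'I_n.+1,
       lam 0 ord0 * lam 0 ord_max *
         (qtri q r%:Z * qtri q (n%:Z - r%:Z) / qtri q n%:Z)
       = lam 0 r * lam 0 (rev_ord r)) :
  [/\ exists rho : B3 -> 'M[R[i]]_n.+1,
        [/\ group_mx_repr rho,
            rho braid1 = sigma1L q lam
          & rho braid2 = sigma2L q lam],
      sigma1L q lam *m sigma2L q lam *m sigma1L q lam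
        = sigma2L q lam *m sigma1L q lam *m sigma2L q lam,
      sigma2L q lam *m sigma1L q lam *m sigma2L q lam
        = (lam 0 ord0 * lam 0 ord_max) *: (Smx q n *m diag_mx lam)
    & forall k m : 'I_n.+1,
        sigma2 q n k m =
          if (k < m)%N then 0
          else (-1) ^+ (k + m) * (qtri q (k%:Z - m%:Z))^-1 * qbin q^-1 k m].
Proof.
set c := lam 0 ord0 * _; set L := diag_mx lam.
set D : 'M[R[i]]_n.+1 := diag_mx (\row_r (q ^+ (r * (n - r)))^-1).
have sharpL : sharp L = diag_mx (\row_r lam 0 (rev_ord r)).
  apply/matrixP => i j; rewrite !mxE (inj_eq rev_ord_inj).
  by case: eqP => // ->.
have LL : L *m sharp L = c *: D.
  rewrite sharpL mulmx_diag; apply/matrixP => i j; rewrite !mxE.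
  by rewrite mulrnAr -lam_cond qtriB // -ltnS.
(* S is supported on k + m = n, where entry k of Lambda^sharp is lambda_m. *)
have LS : sharp L *m Smx q n = Smx q n *m L.
  apply/matrixP => i j; rewrite sharpL mul_diag_mx mul_mx_diag !mxE rev_ord_eq.
  by case: eqP => [->|_]; rewrite ?mulr0 ?mul0r // mulrC.
have aba : sigma1L q lam *m sigma2L q lam *m sigma1L q lam
    = c *: (Smx q n *m L).
  rewrite /sigma1L /sigma2L -/L !mulmxA -[sigma1 q n *m L *m _]mulmxA LL.
  by rewrite -scalemxAr -!scalemxAl sigma1_diag_sigma2_sigma1.
have bab : sigma2L q lam *m sigma1L q lam *m sigma2L q lam
    = c *: (Smx q n *m L).
  rewrite /sigma1L /sigma2L -/L !mulmxA -[_ *m L *m sharp L]mulmxA LL.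
  (* Replacing S Lambda by Lambda^sharp S gives both sides the left factor Lambda^sharp, next to B A
     D B = S. *)
  rewrite -scalemxAr -!scalemxAl -LS -(sigma2_sigma1_diag_sigma2 q n) //.
  by rewrite !mulmxA.
split=> //; last by move=> k m; exact: sigma2E.
  apply: braid_mx_repr; last by rewrite aba bab.
    by rewrite unitmx_mul sigma1_unitmx diag_mx_unit.
  have [_ Bu] := mulmx1_unit (mulmx1C (sigma2_mul_sharp q n)).
  by rewrite unitmx_mul Bu sharpL diag_mx_unit // => i; rewrite mxE.
by rewrite aba bab.
Qed.
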